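(* Let $n$ be a positive integer. If $x,y\in\mathbb{R}^n$ and $|x-y|^2$ is not a rational number, then there exists a map $f:\mathbb{R}^n\to\mathbb{C}^n$ that does not preserve the distance between $x$ and $y$, although $f$ preserves all distances $\sqrt{r}$ with rational $r\geq 0$.
   Context: Define $\varphi_n:\mathbb{C}^n\times\mathbb{C}^n\to\mathbb{C}$ by $\varphi_n((x_1,\dots,x_n),(y_1,\dots,y_n))=(x_1-y_1)^2+\dots+(x_n-y_n)^2$ (no complex conjugation or absolute values). $\mathbb{R}^n$ is regarded as a subset of $\mathbb{C}^n$, and $|\cdot|$ is the Euclidean norm on $\mathbb{R}^n$. A map $f:\mathbb{R}^n\to\mathbb{C}^n$ preserves distance $d\ge 0$ if for all $u,v\in\mathbb{R}^n$, $\varphi_n(u,v)=d^2$ implies $\varphi_n(f(u),f(v))=d^2$. The map $f$ preserves the distance between $x$ and $y$ if $\varphi_n(f(x),f(y))=|x-y|^2$. *)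

(* Defs.v *)
From mathcomp Require Import all_boot all_order all_algebra.
From mathcomp Require Import classical_sets reals.
From mathcomp.real_closed Require Export complex.
Set Implicit Arguments.
Unset Strict Implicit.
Unset Printing Implicit Defensive.
Import Order.TTheory GRing.Theory Num.Theory.
Local Open Scope ring_scope.
Local Open Scope complex_scope.

(* No conjugation or modulus is taken: the values are arbitrary complex
   numbers, and phi u v = 0 does not imply u = v. *)
Definition phi (R : realType) (n : nat) (x y : 'rV[R[i]]_n) : R[i] :=
  \sum_(i < n) (x 0 i - y 0 i) ^+ 2.

Definition embC (R : realType) (n : nat) (u : 'rV[R]_n) : 'rV[R[i]]_n :=
  map_mx (real_complex R) u.

(* MathComp-Analysis equips 'rV[R]_n with the sup norm `|u|, hence a separate
   definition for the Euclidean one. *)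
Definition enorm (R : realType) (n : nat) (u : 'rV[R]_n) : R :=
  Num.sqrt (\sum_(i < n) u 0 i ^+ 2).

Definition preserves_distance (R : realType) (n : nat)
    (f : 'rV[R]_n -> 'rV[R[i]]_n) (d : R) : Prop :=
  forall u v : 'rV[R]_n,
    phi (embC u) (embC v) = (d ^+ 2)%:C -> phi (f u) (f v) = (d ^+ 2)%:C.

Definition preserves_distance_between (R : realType) (n : nat)
    (f : 'rV[R]_n -> 'rV[R[i]]_n) (x y : 'rV[R]_n) : Prop :=
  phi (f x) (f y) = (enorm (x - y) ^+ 2)%:C.

(* Main.v *)
Require Import Defs.
From HB Require Import structures.
From mathcomp Require Import all_boot all_order all_algebra qpoly.
From mathcomp Require Import boolp classical_sets reals.
Set Implicit Arguments.
Unset Strict Implicit.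
Unset Printing Implicit Defensive.
Import Order.TTheory GRing.Theory Num.Theory.
Local Open Scope classical_set_scope.
Local Open Scope ring_scope.

(** The map [f] applies one field embedding [theta : R -> C] to every coordinate.
    Since [phi] is a polynomial with integer coefficients,
    [phi (f u) (f v) = theta (|u - v|^2)], and [theta] fixes the rationals, so
    such an [f] preserves every distance [sqrt r] with [r] rational. It remains
    to find an embedding [theta] that moves a given irrational real
    [t = |x - y|^2]; this is [moving_embedding].

    No transcendence bases are needed. Take, by Zorn's lemma, a subfield [F] of
    the reals that is maximal among those avoiding [t]. Then the reals are
    algebraic over [F] ([algebraic_over_maximal_avoiding]): any [u] outside [F]
    makes [t] a fraction in [u] over [F], and taking [u = t^2] shows that [t]
    itself is algebraic over [F]. As [t] is not in [F], its minimal polynomial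
    has degree at least 2, and in characteristic 0 it has a root [b <> t] in the
    complex numbers ([irredp_other_root]). The embedding of [F(t)] over [F] that
    sends [t] to [b] extends to the reals, because these are algebraic over
    [F(t)] and the complex numbers are algebraically closed
    ([embedding_extension]).

    A partial embedding of [L] into [C] is handled as its graph, which is a
    subfield of the ring [L * C]. Both applications of Zorn's lemma, in [L] and
    in [L * C], and both adjunctions of an element are thus instances of
    statements on subfields of a commutative ring [S]. *)

(** * Subfields of a commutative ring *)

(** The last clause makes a subring closed under division into a field, and it
    carries content when [S] has zero divisors. In [S = L * C] the nonzero
    nonunits are the pairs with exactly one zero coordinate, so a subfield is
    exactly the graph of an isomorphism between a subfield of [L] and one of
    [C]. *)
Definition is_subfield (S : comUnitRingType) (A : set S) : Prop :=
  [/\ A 1,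
      forall x y, A x -> A y -> A (x - y),
      forall x y, A x -> A y -> A (x / y)
    & forall x, A x -> x != 0 -> x \is a GRing.unit].

(** Bundling a subset with the proof that it is a subfield lets the algebraic
    structures on [subfield_type] below be inferred. *)
Record subfield (S : comUnitRingType) :=
  Subfield {subfield_set : set S; subfield_setP : is_subfield subfield_set}.

Section SubfieldType.
Variables (S : comUnitRingType) (A : subfield S).

Definition subfield_pred : pred S := fun x => `[< subfield_set A x >].

Lemma subfield_divring_closed : divring_closed subfield_pred.
Proof.
case: (subfield_setP A) => A1 AB AD _.
split=> [|x y /asboolP Ax /asboolP Ay|x y /asboolP Ax /asboolP Ay]; apply/asboolP => //.
- exact: AB.
- exact: AD.
Qed.

HB.instance Definition _ :=
  GRing.isDivringClosed.Build S subfield_pred subfield_divring_closed.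

Definition subfield_type : Type := {x : S | subfield_pred x}.

HB.instance Definition _ := SubChoice.on subfield_type.
HB.instance Definition _ := [SubChoice_isSubComUnitRing of subfield_type by <:].

Lemma subfield_type_field : GRing.field_axiom subfield_type.
Proof.
move=> x x0; have [_ _ _ Aunit] := subfield_setP A.
apply/unitrP.
have xU : val x \is a GRing.unit.
  apply: Aunit; first exact/asboolP/(valP x).
  by apply: contra x0 => /eqP x0; apply/eqP/val_inj; rewrite x0 rmorph0.
have Vx : subfield_pred (val x)^-1 by have := rpredVr (valP x).
exists (Sub (val x)^-1 Vx : subfield_type).
split; apply/val_inj; rewrite rmorphM rmorph1 /=; [exact: mulVr | exact: mulrV].
Qed.

HB.instance Definition _ :=
  GRing.ComUnitRing_isField.Build subfield_type subfield_type_field.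

End SubfieldType.

(** Replaces a subfield by an abstract field with an embedding, so that
    polynomials over it are available. *)
Lemma is_subfieldP (S : comUnitRingType) (A : set S) : is_subfield A ->
  exists (K : fieldType) (iota : {rmorphism K -> S}), range iota = A.
Proof.
move=> Asub; pose B := Subfield Asub.
exists (subfield_type B), (val : {rmorphism subfield_type B -> S}).
apply/seteqP; split=> [_ [k _ <-]|x Ax]; first exact/asboolP/(valP k).
by exists (Sub x (asboolT Ax) : subfield_type B).
Qed.

(** The two uses are [N = [set t]] in a field, for a subfield maximal among those
    avoiding [t], and [N = set0] in a product, for a maximal graph. *)
Lemma maximal_subfield (S : comUnitRingType) (A N : set S) :
  is_subfield A -> (forall x, A x -> ~ N x) ->
  exists G : set S, [/\ is_subfield G, A `<=` G, forall x, G x -> ~ N x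
    & forall B, is_subfield B -> G `<=` B -> (forall x, B x -> ~ N x) ->
      B `<=` G].
Proof.
move=> Asub AN.
(* Zorn's lemma is applied to the [X] for which [A `|` X] is admissible: with this
   encoding the empty chain has the union [A]. *)
pose P := [set X | is_subfield (A `|` X) /\ forall x, (A `|` X) x -> ~ N x].
have P0 : P set0 by split; rewrite setU0.
have [F FP Ftot|G0 [[G0sub G0N] G0max]] := @Zorn_bigcup _ P.
  set U := \bigcup_(X in F) X.
  have UP x y : (A `|` U) x -> (A `|` U) y ->
      exists X, [/\ P X, A `|` X `<=` A `|` U, (A `|` X) x & (A `|` X) y].
    have sub X : F X -> A `|` X `<=` A `|` U.
      by move=> FX; apply: setUS; apply: bigcup_sup.
    move=> [Ax|[X FX Xx]] [Ay|[Y FY Yy]].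
    - by exists set0; split; rewrite ?setU0 //; exact: subsetUl.
    - by exists Y; split; [exact: FP | exact: sub | left | right].
    - by exists X; split; [exact: FP | exact: sub | right | left].
    - have [XY|YX] := Ftot _ _ FX FY.
      + by exists Y; split; [exact: FP | exact: sub | right; exact: XY | right].
      + by exists X; split; [exact: FP | exact: sub | right | right; exact: YX].
  split; last first.
    by move=> x Ux; have [X [[_ +] _ Xx _]] := UP x x Ux Ux; apply.
  split.
  - by left; case: Asub.
  - move=> x y Ux Uy; have [X [[[_ XB _ _] _] sub Xx Xy]] := UP x y Ux Uy.
    exact/sub/XB.
  - move=> x y Ux Uy; have [X [[[_ _ XD _] _] sub Xx Xy]] := UP x y Ux Uy.
    exact/sub/XD.
  - move=> x Ux; have [X [[[_ _ _ XU] _] _ Xx _]] := UP x x Ux Ux.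
    exact: XU.
exists (A `|` G0); split=> // B Bsub sGB BN.
have AB : A `|` B = B by apply/setUidPr; apply: subset_trans sGB.
apply: contrapT => nBG; apply: (G0max B).
  split; first by apply: subset_trans sGB.
  by move=> BG0; apply: nBG; apply: (subset_trans BG0).
by split; rewrite AB.
Qed.

(** * Adjunction of an element *)

Section Adjoin.
Variables (K : fieldType) (S : comUnitRingType) (iota : {rmorphism K -> S}).

(** The field [iota(K)(u)]: writing its elements as fractions of values of
    polynomials gives closure under division without a division algorithm. *)
Definition adjoin (u : S) : set S :=
  [set a | exists p q : {poly K}, (map_poly iota q).[u] \is a GRing.unit /\
     a = (map_poly iota p).[u] / (map_poly iota q).[u]].

Lemma adjoin_poly (u : S) (p : {poly K}) : adjoin u (map_poly iota p).[u].
Proof. by exists p, 1; rewrite rmorph1 hornerE unitr1 divr1. Qed.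

Lemma adjoin_gen u : adjoin u u.
Proof. by have := adjoin_poly u 'X; rewrite map_polyX hornerX. Qed.

Lemma adjoin_sub u : range iota `<=` adjoin u.
Proof.
by move=> _ [k _ <-]; have := adjoin_poly u k%:P; rewrite map_polyC hornerC.
Qed.

(** Closure under the operations is that of fractions; the hypothesis is what
    keeps zero divisors out, so it is the only point to check in an
    application. *)
Lemma adjoin_subfield (u : S) :
  (forall p : {poly K}, (map_poly iota p).[u] != 0 ->
     (map_poly iota p).[u] \is a GRing.unit) ->
  is_subfield (adjoin u).
Proof.
move=> evU; split.
- by have := adjoin_poly u 1; rewrite rmorph1 hornerE.
- move=> _ _ [p [q [qU ->]]] [p' [q' [q'U ->]]].
  exists (p * q' - p' * q), (q * q').
  rewrite rmorphB !rmorphM !hornerE unitrM qU q'U; split => //.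
  by rewrite invrM // mulrBl mulrA mulrK // [_^-1 * _]mulrC mulrA mulrK.
- move=> _ _ [p [q [qU ->]]] [p' [q' [q'U ->]]].
  have [p'0|p'N0] := eqVneq (map_poly iota p').[u] 0.
    rewrite p'0 mul0r invr0 mulr0.
    by have := adjoin_poly u 0; rewrite rmorph0 hornerE.
  exists (p * q'), (q * p').
  have p'U := evU _ p'N0.
  rewrite !rmorphM !hornerE unitrM qU p'U; split => //.
  by rewrite !invrM ?unitrV // invrK [RHS]mulrA [RHS]mulrAC -[RHS]mulrA mulrACA.
- move=> _ [p [q [qU ->]]] pq0.
  rewrite unitrM unitrV qU andbT evU //.
  by apply: contraNneq pq0 => ->; rewrite mul0r.
Qed.

End Adjoin.

(** * Irreducible polynomials and their roots *)

(** A nonzero polynomial of least degree vanishing at [u] is irreducible, since one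
    of the factors of a product vanishes at [u]. *)
Lemma irreducible_annihilator (K L : fieldType) (i : {rmorphism K -> L}) (u : L) :
  algebraicOver i u ->
  exists m : {poly K}, irreducible_poly m /\ root (map_poly i m) u.
Proof.
move=> [p p0 pu].
pose P n := `[< exists q : {poly K},
  [/\ q != 0, root (map_poly i q) u & size q = n] >].
have exP : exists n, P n by exists (size p); apply/asboolP; exists p.
have [n /asboolP[m [m0 mu <-]] min_m] := ex_minnP exP.
have {}min_m q : q != 0 -> root (map_poly i q) u -> (size m <= size q)%N.
  by move=> q0 qu; apply/min_m/asboolP; exists q.
exists m; split => //; split=> [|q q1 qm].
  rewrite ltnNge; apply/negP => /size1_polyC mE.
  by move: mu m0; rewrite mE map_polyC rootC fmorph_eq0 polyC_eq0 => ->.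
have q0 : q != 0 by apply: contraNneq m0 => q0; rewrite -dvd0p -q0.
have [r mE] := dvdpP _ _ qm.
have r0 : r != 0 by apply: contraNneq m0 => r0; rewrite mE r0 mul0r.
move: mu; rewrite mE rmorphM rootM => /orP[ru|qu]; last first.
  by rewrite -dvdp_size_eqp -?mE // eqn_leq dvdp_leq // min_m.
have := min_m _ r0 ru; rewrite mE size_mul // (polySpred r0) addSn /= -addn1.
rewrite leq_add2l => q_le1; case/negP: q1.
by rewrite eqn_leq q_le1 size_poly_gt0.
Qed.

(** An irreducible [m] that does not divide [p] is coprime to it, and a Bezout
    relation forbids common roots in any extension. The right-hand side does
    not depend on [u]: the same polynomials vanish at all roots of [m],
    even at roots lying in different extensions of [K]. *)
Lemma irredp_root_dvd (K L : fieldType) (i : {rmorphism K -> L}) (m p : {poly K})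
    (u : L) : irreducible_poly m -> root (map_poly i m) u ->
  root (map_poly i p) u = (m %| p).
Proof.
move=> m_irr mu; apply/idP/idP => [pu|/dvdpP[r ->]]; last first.
  by rewrite rmorphM rootM mu orbT.
apply: contraLR pu => ndvd; apply: (coprimep_root _ mu).
by rewrite coprimep_map irreducible_poly_coprime.
Qed.

(** Otherwise [a] would be a multiple root, hence a root of the derivative [m^`()];
    but [m], being irreducible, would then divide [m^`()], which is nonzero in
    characteristic 0 and of smaller degree. *)
Lemma irredp_other_root (K : fieldType) (C : closedFieldType)
    (j : {rmorphism K -> C}) (m : {poly K}) (a : C) :
  [pchar K] =i pred0 -> irreducible_poly m -> (2 < size m)%N ->
  root (map_poly j m) a -> exists2 b, b != a & root (map_poly j m) b.
Proof.
move=> char0 m_irr m_gt2 ma.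
have /factor_theorem[h mE] := ma.
have h_size : size h != 1%N.
  apply: contraTneq m_gt2 => h1; rewrite -leqNgt -(size_map_poly j) mE.
  by rewrite (leq_trans (size_polyMleq _ _)) // size_XsubC h1.
have /closed_rootP[b hb] := h_size.
exists b; last by rewrite mE rootM hb.
apply: contraTneq ma => ba; rewrite {}ba in hb.
have dm0 : m^`() != 0.
  have m_gt0 : (0 < (size m).-1)%N by case: (size m) m_gt2 => [|[]].
  apply/eqP => /(congr1 (coefp (size m).-2))/eqP.
  rewrite /coefp coef_deriv coef0 prednK // -mulr_natr mulf_eq0.
  rewrite ((pcharf0P K).1 char0) -lead_coefE lead_coef_eq0.
  by rewrite (negPf (irredp_neq0 m_irr)) eqn0Ngt m_gt0.
have ndvd : ~~ (m %| m^`()).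
  apply/negP => /(dvdp_leq dm0); rewrite leqNgt lt_size_deriv //.
  exact: irredp_neq0.
apply: contra ndvd => ma; rewrite -(irredp_root_dvd _ m_irr ma).
rewrite -deriv_map mE derivM derivXsubC mulr1 rootE hornerD hornerM.
by rewrite hornerXsubC subrr mulr0 add0r.
Qed.

(** * Maximal subfields avoiding an element *)

(** If [u] is outside [K] then [t = p(u) / q(u)] with [p], [q] over [K]. So [u] is
    a root of [p - t q], which is nonzero because [t] is not in [K], and whose
    coefficients are algebraic over [K] as soon as [t] is. To see that [t] is
    algebraic, take [u = t^2]: then [t] is a root of [X q(X^2) - p(X^2)]. *)
Lemma algebraic_over_maximal_avoiding (K L : fieldType)
    (i : {rmorphism K -> L}) (t : L) :
  ~ range i t -> (forall u, ~ range i u -> adjoin i u t) ->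
  forall u, algebraicOver i u.
Proof.
move=> iNt adj.
have frac u : ~ range i u -> exists p q : {poly K},
    q != 0 /\ t * (map_poly i q).[u] = (map_poly i p).[u].
  move=> /adj[p [q [qU ->]]]; exists p, q; rewrite divrK //; split => //.
  by apply: contraTneq qU => ->; rewrite rmorph0 horner0 unitr0.
have t_alg : algebraicOver i t.
  have [[k _ kt]|/frac[p [q [q0 pq]]]] := pselect (range i (t ^+ 2)).
    exists ('X^2 - k%:P); first by rewrite -size_poly_eq0 size_XnsubC.
    by rewrite rmorphB /= map_polyXn map_polyC /= kt rootE !hornerE subrr.
  exists ('X * (q \Po 'X^2) - (p \Po 'X^2)); last first.
    rewrite rmorphB rmorphM /= map_polyX !map_comp_poly map_polyXn rootE.
    by rewrite !hornerE !horner_comp hornerXn pq subrr.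
  (* [X q(X^2)] has odd degree, and [p(X^2)] has even degree or is zero. *)
  rewrite subr_eq0; apply/eqP => /(congr1 (fun r : {poly K} => odd (size r).-1)).
  have qX0 : q \Po 'X^2 != 0 by rewrite comp_poly_eq0 // size_polyXn.
  rewrite mulrC size_mulX // size_comp_poly size_polyXn /= muln2 odd_double.
  by rewrite (polySpred qX0) size_comp_poly size_polyXn /= muln2 odd_double.
move=> u; have [[k _ <-]|/frac[p [q [q0 pq]]]] := pselect (range i u).
  exact: algebraic_id.
apply/integral_algebraic.
apply: (@integral_root _ _ i (map_poly i p - t *: map_poly i q)).
- rewrite subr_eq0; apply/eqP => E; apply: iNt.
  (* [p = t q] gives [t] as the quotient of the coefficients at the degree of [q]. *)
  exists (p`_(size q).-1 / lead_coef q) => //.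
  rewrite fmorph_div /= -coef_map E coefZ coef_map mulfK //.
  by rewrite fmorph_eq0 lead_coef_eq0.
- by rewrite rootE !hornerE pq subrr.
move=> _ /(nthP 0)[n _ <-]; rewrite coefB coefZ !coef_map.
apply: integral_sub; first exact: integral_id.
by apply: integral_mul; [exact/integral_algebraic | exact: integral_id].
Qed.

(** * Extension of embeddings *)

Section PairMorphism.
Variables (K L C : fieldType) (i : {rmorphism K -> L}) (j : {rmorphism K -> C}).

(** Its range is the graph of the partial map from [L] to [C] that sends [i k] to
    [j k]. *)
Definition pair_morphism (k : K) : L * C := (i k, j k).

Lemma pair_morphism_is_zmod : zmod_morphism pair_morphism.
Proof. by move=> x y; rewrite /pair_morphism !rmorphB. Qed.

Lemma pair_morphism_is_monoid : monoid_morphism pair_morphism.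
Proof. by split=> [|x y]; rewrite /pair_morphism ?rmorph1 ?rmorphM. Qed.

HB.instance Definition _ :=
  GRing.isZmodMorphism.Build K (L * C)%type pair_morphism pair_morphism_is_zmod.
HB.instance Definition _ :=
  GRing.isMonoidMorphism.Build K (L * C)%type pair_morphism
    pair_morphism_is_monoid.

Lemma horner_pair_morphism (p : {poly K}) (u : L) (v : C) :
  (map_poly pair_morphism p).[(u, v)] = ((map_poly i p).[u], (map_poly j p).[v]).
Proof.
elim/poly_ind: p => [|p c IHp]; first by rewrite !rmorph0 !horner0.
rewrite !rmorphD !rmorphM /= !map_polyX !map_polyC /= !hornerE.
by rewrite IHp.
Qed.

(** By [irredp_root_dvd] the polynomials over [K] vanishing at [u] are those
    vanishing at [v], so [p(u, v)] is zero or has two nonzero coordinates. In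
    terms of embeddings: the isomorphism [i(K) -> j(K)] extends to
    [i(K)(u) -> j(K)(v)], with [u] sent to [v]. *)
Lemma adjoin_pair_subfield (m : {poly K}) (u : L) (v : C) :
  irreducible_poly m -> root (map_poly i m) u -> root (map_poly j m) v ->
  is_subfield (adjoin pair_morphism (u, v)).
Proof.
move=> m_irr mu mv; apply: adjoin_subfield => p; rewrite horner_pair_morphism.
have : root (map_poly i p) u = root (map_poly j p) v.
  by rewrite (irredp_root_dvd _ m_irr mu) (irredp_root_dvd _ m_irr mv).
rewrite !rootE => uv; rewrite xpair_eqE uv andbb => pv.
by apply/andP; split; rewrite /= unitfE ?uv.
Qed.

End PairMorphism.

Lemma range_subfield (K : fieldType) (S : comUnitRingType)
  (iota : {rmorphism K -> S}) : is_subfield (range iota).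
Proof.
split=> [|_ _ [x _ <-] [y _ <-]|_ _ [x _ <-] [y _ <-]|_ [x _ <-] x0].
- by exists 1; rewrite ?rmorph1.
- by exists (x - y); rewrite ?rmorphB.
- have [->|y0] := eqVneq y 0; first by exists 0; rewrite ?rmorph0 ?invr0 ?mulr0.
  by exists (x / y) => //; rewrite rmorph_div ?unitfE.
- rewrite rmorph_unit // unitfE.
  by apply: contraNneq x0 => ->; rewrite rmorph0.
Qed.

Lemma algebraic_enlarge_base (K M L : fieldType) (i : {rmorphism K -> L})
    (i' : {rmorphism M -> L}) (u : L) :
  range i `<=` range i' -> algebraicOver i u -> algebraicOver i' u.
Proof.
move=> sub [p p0 pu]; apply/integral_algebraic.
apply: (@integral_root _ _ i' (map_poly i p)) => //; first by rewrite map_poly_eq0.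
move=> _ /(nthP 0)[n _ <-]; rewrite coef_map /=.
by have [|k _ <-] := sub (i p`_n); [exists p`_n | exact: integral_id].
Qed.

(** A maximal graph [G] containing the pairs [(i k, j k)] projects onto [L]: given
    [u] in [L], the minimal polynomial of [u] over the first projection of [G],
    transported to [C], has a root [v] there, and the pair [(u, v)] can be
    adjoined to [G]. *)
Lemma embedding_extension (K L : fieldType) (C : closedFieldType)
    (i : {rmorphism K -> L}) (j : {rmorphism K -> C}) :
  (forall u, algebraicOver i u) ->
  exists theta : {rmorphism L -> C}, forall k, theta (i k) = j k.
Proof.
move=> i_alg.
have [G [Gsub ijG _ Gmax]] :=
  @maximal_subfield _ _ set0 (range_subfield (pair_morphism i j))
    (fun _ _ => id).
have [M [iota iotaG]] := is_subfieldP Gsub.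
pose i' : {rmorphism M -> L} := fst \o iota.
pose j' : {rmorphism M -> C} := snd \o iota.
have iotaE : pair_morphism i' j' =1 iota by move=> k; rewrite [RHS]surjective_pairing.
have i'_alg u : algebraicOver i' u.
  apply: algebraic_enlarge_base (i_alg u) => _ [k _ <-].
  have : G (pair_morphism i j k) by apply: ijG; exists k.
  by rewrite -iotaG => -[l _ lE]; exists l; rewrite ?/i' //= lE.
have i'_onto u : exists k, i' k = u.
  have [m [m_irr mu]] := irreducible_annihilator (i'_alg u).
  have /closed_rootP[v mv] : size (map_poly j' m) != 1%N.
    by rewrite size_map_poly; case: m_irr; case: (size m) => [|[]].
  have subA : G `<=` adjoin (pair_morphism i' j') (u, v).
    rewrite -iotaG => _ [k _ <-]; rewrite -iotaE.
    by apply: adjoin_sub; exists k.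
  have : G (u, v).
    apply: (Gmax _ (adjoin_pair_subfield m_irr mu mv) subA (fun _ _ => id)).
    exact: adjoin_gen.
  by rewrite -iotaG => -[k _ kE]; exists k; rewrite /i' /= kE.
have [g gK] := choice i'_onto.
have Kg : cancel i' g by move=> k; apply: (fmorph_inj i'); rewrite gK.
pose g' : {rmorphism L -> M} := HB.pack g
  (GRing.isZmodMorphism.Build L M g (can2_zmod_morphism Kg gK))
  (GRing.isMonoidMorphism.Build L M g (can2_monoid_morphism Kg gK)).
exists (j' \o g' : {rmorphism L -> C}) => k.
have : G (pair_morphism i j k) by apply: ijG; exists k.
rewrite -iotaG => -[l _ lE].
have -> : i k = i' l by rewrite /i' /= lE.
by rewrite /= Kg lE.
Qed.

(** * Embeddings moving an element outside a subfield *)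

(** The relative form of the result, over any subfield [A] of [L] in place of the
    rationals. *)
Lemma moving_embedding (L : fieldType) (C : closedFieldType)
    (inj : {rmorphism L -> C}) (A : set L) (t : L) :
  [pchar L] =i pred0 -> is_subfield A -> ~ A t ->
  exists theta : {rmorphism L -> C},
    (forall a, A a -> theta a = inj a) /\ theta t != inj t.
Proof.
move=> char0 Asub At.
have A_avoids x : A x -> ~ [set t] x by move=> Ax xt; apply: At; rewrite -xt.
have [F [Fsub AF F_avoids Fmax]] := maximal_subfield Asub A_avoids.
have [K [i iF]] := is_subfieldP Fsub.
have it : ~ range i t by rewrite iF => /F_avoids; apply.
have i_alg : forall u, algebraicOver i u.
  apply: (algebraic_over_maximal_avoiding it) => u iu.
  apply: contrapT => Nt; apply: iu; rewrite iF.
  have uA : is_subfield (adjoin i u).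
    by apply: adjoin_subfield => p; rewrite unitfE.
  apply: (Fmax _ uA) (adjoin_gen i u); last by move=> x xA xt; apply: Nt; rewrite -xt.
  by rewrite -iF; apply: adjoin_sub.
have [m [m_irr mt]] := irreducible_annihilator (i_alg t).
pose j : {rmorphism K -> C} := inj \o i.
have m_gt2 : (2 < size m)%N.
  rewrite ltnNge; apply/negP => m2; apply: it.
  have m_size : size m = 2%N by apply/eqP; rewrite eqn_leq m2; case: m_irr.
  (* A linear [m] has its root in [K]. *)
  exists (- (m`_0 / m`_1)) => //.
  have m1 : i m`_1 != 0.
    by rewrite fmorph_eq0 -[1%N]/(2%N.-1) -m_size -lead_coefE lead_coef_eq0 irredp_neq0.
  move: mt; rewrite rootE horner_coef size_map_poly m_size.
  rewrite !big_ord_recl big_ord0 /= !coef_map expr0 expr1 mulr1 addr0 addr_eq0.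
  by move=> /eqP E; rewrite rmorphN fmorph_div E mulNr opprK mulrAC mulfV ?mul1r.
have mjt : root (map_poly j m) (inj t).
  by rewrite map_poly_comp fmorph_root.
have Kchar0 : [pchar K] =i pred0.
  by move=> p; rewrite -(fmorph_pchar i) char0.
have [b bt mb] := irredp_other_root Kchar0 m_irr m_gt2 mjt.
have [M [iota iotaE]] := is_subfieldP (adjoin_pair_subfield m_irr mt mb).
have iotaP x : adjoin (pair_morphism i j) (t, b) x ->
    exists2 k, (iota k).1 = x.1 & (iota k).2 = x.2.
  by rewrite -iotaE => -[k _ <-]; exists k.
have iota_alg u : algebraicOver (fst \o iota) u.
  apply: algebraic_enlarge_base (i_alg u) => _ [k _ <-].
  have [|l lE _] := iotaP (pair_morphism i j k); last by exists l.
  by apply: adjoin_sub; exists k.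
have [theta thetaE] := embedding_extension (snd \o iota : {rmorphism M -> C}) iota_alg.
have thetaP x : adjoin (pair_morphism i j) (t, b) x -> theta x.1 = x.2.
  by move=> /iotaP[k <- <-]; apply: thetaE.
exists theta; split; last first.
  by have /= -> := thetaP (t, b) (adjoin_gen _ _).
move=> a /AF; rewrite -iF => -[k _ <-].
by apply: (thetaP (pair_morphism i j k)); apply: adjoin_sub; exists k.
Qed.

Theorem theorem1 (R : realType) (n : nat) (n_gt0 : (0 < n)%N)
    (x y : 'rV[R]_n) (irr_xy : irrational (enorm (x - y) ^+ 2)) :
  exists f : 'rV[R]_n -> 'rV[R[i]]_n,
    ~ preserves_distance_between f x y /\
    (forall r : rat, 0 <= r -> preserves_distance f (Num.sqrt (ratr r))).
Proof.
have phi_map (theta : {rmorphism R -> R[i]}) (u v : 'rV[R]_n) :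
    phi (map_mx theta u) (map_mx theta v) = theta (\sum_i (u - v) 0 i ^+ 2).
  rewrite /phi rmorph_sum; apply: eq_bigr => i _.
  by rewrite !mxE rmorphXn rmorphB.
have enormE : enorm (x - y) ^+ 2 = \sum_i (x - y) 0 i ^+ 2.
  by rewrite sqr_sqrtr // sumr_ge0 // => i _; rewrite sqr_ge0.
have [theta [thetaQ theta_t]] := moving_embedding (real_complex R)
  (pchar_num R) (range_subfield (ratr : {rmorphism rat -> R})) irr_xy.
exists (map_mx theta); split.
  by move=> /eqP; rewrite phi_map -enormE; apply/negP.
move=> r r0 u v; rewrite !phi_map => /(fmorph_inj (real_complex R)) ->.
by rewrite sqr_sqrtr ?ler0q // thetaQ //; exists r.
Qed.
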